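(* Suppose $U$ is an open set in $\mathbb R^{n+1}$ such that a portion of its boundary $\Omega\subset\{x_{n+1}=0\}\cap\partial U$ is an open set in $\mathbb R^n$ (where $\{x_{n+1}=0\}$ is identified with $\mathbb R^n$). Let $u$ be a harmonic function in $U\cup\Omega$. Denote by $Du=(D_1u,\dots,D_nu)$ the tangential component of the full gradient of $u$ on $\Omega$. Let $$p=|Du|^2+(D_{n+1}u)^2\quad\text{and}\quad q=D_{n+1}p.$$ Then $u$ satisfies $$\operatorname{div}\frac{Du}{\sqrt{p-|Du|^2}}+\frac12\,\frac{\sigma q}{p-|Du|^2}=0$$ in $\Omega$, where $\operatorname{div}$ is the divergence operator in $\mathbb R^n$ and $\sigma=\operatorname{sgn}D_{n+1}u$.
   Context: $D_i$ denotes the partial derivative with respect to $x_i$, $i=1,\dots,n+1$. Harmonic means satisfying the Laplace equation in $\mathbb R^{n+1}$, $\sum_{i=1}^{n+1}D_{ii}u=0$. $Du$ denotes only the first $n$ components of the gradient, so $p$ is the squared magnitude of the full gradient of $u$ in $\mathbb R^{n+1}$. $\operatorname{div}F=\sum_{i=1}^nD_iF_i$ involves only the variables $x_1,\dots,x_n$. *)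

(* Defs.v *)
From HB Require Import structures.
From mathcomp Require Import all_boot all_order all_algebra.
From mathcomp Require Import all_classical all_reals all_analysis.
Set Implicit Arguments.
Unset Strict Implicit.
Unset Printing Implicit Defensive.
Import Order.TTheory GRing.Theory Num.Theory.
Import numFieldNormedType.Exports.
Local Open Scope classical_set_scope.
Local Open Scope ring_scope.

Section Defs.
Context {R : realType}.

(* R^(n+1) is 'rV[R]_(n + 1): the tangential indices are [lshift 1 i] with
   i : 'I_n and the normal index, that of x_(n+1), is [rshift n ord0]. *)
Definition inj_hyperplane n (x : 'rV[R]_n) : 'rV[R]_(n + 1) := row_mx x 0.

Definition normal_index n : 'I_(n + 1) := rshift n ord0.

Definition frontier (T : topologicalType) (A : set T) : set T :=
  closure A `\` interior A.

(* [g] is the partial derivative of [f] with respect to x_i on the set [S] and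
   is continuous on [S].  Only increments that stay in [S] are used, so the
   derivative is the usual one at interior points of [S] and may be one-sided
   at the other points.  Only the values of [f] and [g] on [S] matter.
   If S is the union of an open set U and a part Omega of its frontier, [g] is
   determined on S by [f]: on U by the difference quotients, and on Omega,
   which lies in the closure of U, by continuity.  If moreover f is C^1 on an
   open neighbourhood of S, [g] is the restriction of its classical partial
   derivative. *)
Definition is_partial m (S : set 'rV[R]_m) (i : 'I_m) (f g : 'rV[R]_m -> R) :=
  {within S, continuous g} /\
  forall x, S x ->
    h^-1 *: (f (h *: delta_mx 0 i + x) - f x)
      @[h --> within [set h : R | S (h *: delta_mx 0 i + x)] 0^'] --> g x.

(* Choice of such a [g], and 0 if there is none; meaningful on [S] only. *)
Definition partial m (S : set 'rV[R]_m) (i : 'I_m) (f : 'rV[R]_m -> R) :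
    'rV[R]_m -> R :=
  xget (fun=> 0) [set g | is_partial S i f g].

Definition C1_on m (S : set 'rV[R]_m) (f : 'rV[R]_m -> R) :=
  {within S, continuous f} /\
  forall i, is_partial S i f (partial S i f).

Definition C2_on m (S : set 'rV[R]_m) (f : 'rV[R]_m -> R) :=
  C1_on S f /\ forall i, C1_on S (partial S i f).

Definition harmonic_on m (S : set 'rV[R]_m) (u : 'rV[R]_m -> R) :=
  C2_on S u /\
  forall x, S x -> \sum_(i < m) partial S i (partial S i u) x = 0.

(* The matrix norm of the library is the sup norm. *)
Definition sqr_enorm n (w : 'rV[R]_n) : R := \sum_(i < n) w 0 i ^+ 2.

Definition div_derivable n (F : 'rV[R]_n -> 'rV[R]_n) (x : 'rV[R]_n) :=
  forall i : 'I_n, derivable (fun y => F y 0 i) x (delta_mx 0 i).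

Definition div n (F : 'rV[R]_n -> 'rV[R]_n) (x : 'rV[R]_n) : R :=
  \sum_(i < n) 'D_(delta_mx 0 i) (fun y => F y 0 i) x.

End Defs.

(* Main.v *)
Require Import Defs.
From HB Require Import structures.
From mathcomp Require Import all_boot all_order all_algebra.
From mathcomp Require Import all_classical all_reals all_analysis.
From mathcomp Require Import ring lra.
Import Order.TTheory GRing.Theory Num.Theory.
Import numFieldNormedType.Exports.
Local Open Scope classical_set_scope.
Local Open Scope ring_scope.

(** Write D_k for the derivative in direction k, nu for the normal index, and
    s for the sign of D_nu u.  On Omega the difference p - |Du|^2 is
    (D_nu u)^2, so the vector field is s Du / D_nu u, where s is locally
    constant because D_nu u is continuous and nonzero (near_sgr).  The quotient
    rule gives

      div F = s (sum_i D_ii u / D_nu u - sum_i D_i u D_i D_nu u / (D_nu u)^2),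

    while differentiating p, the sum of the squares of all D_k u, gives
    q = 2 (sum_i D_i u D_nu D_i u + D_nu u D_nu D_nu u).  Hence

      div F + s q / (2 (D_nu u)^2)
        = s (sum_i D_ii u + D_nu D_nu u) / D_nu u
          + s sum_i D_i u (D_nu D_i u - D_i D_nu u) / (D_nu u)^2.

    The first term vanishes by harmonicity, the second by the symmetry of
    second derivatives.

    Since u lives only on S, the union of U and Omega, three points need care
    on Omega.
    - Normal derivatives on Omega cannot always be read off difference
      quotients: U may contain no normal segment ending at a given point.
      They are however continuous on S and U is dense in S, so any identity
      between them passes from U to Omega (within_continuous_eq_closure).
      This gives both the uniqueness of q (is_partial_unique) and the symmetry
      of second derivatives on S (partialC), the latter being the classical
      theorem of Schwarz on the open set U (mixed_derivatives_eq).
    - Tangential derivatives on Omega are classical derivatives of the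
      restriction to the hyperplane, because Omega is open there
      (is_derive_trace); this is what connects div F to the second
      derivatives of u on S.
    - The product and sum rules hold for derivatives relative to an arbitrary
      set S (is_partialM, is_partialD), which gives the derivative of p. *)

(** * Symmetry of second derivatives *)

Lemma is_derive_line {R : numFieldType} {V W : normedModType R} {f : V -> W}
    {a v : V} {t : R} {df : W} :
  is_derive (t *: v + a) v f df -> is_derive t 1 (fun s => f (s *: v + a)) df.
Proof.
case=> dvf <-.
have E : (fun h : R => h^-1 *: (((fun s => f (s *: v + a)) \o shift t) (h *: 1)
            - f (t *: v + a)))
       = (fun h : R => h^-1 *: ((f \o shift (t *: v + a)) (h *: v)
            - f (t *: v + a))).
  by apply/funext => h /=; rewrite [h *: 1]mulr1 scalerDl addrA.
by split; rewrite /derivable /derive E.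
Qed.

(** Apply the mean value theorem to s |-> phi s h - phi s 0, and then to
    t |-> A s t at the intermediate point found. *)
Lemma mixed_difference_mean_value {R : realType} {phi A B : R -> R -> R} {h : R} :
  0 < h ->
  (forall s t, s \in `[0, h] -> t \in `[0, h] ->
    is_derive s 1 (phi^~ t) (A s t)) ->
  (forall s t, s \in `[0, h] -> t \in `[0, h] ->
    is_derive t 1 (A s) (B s t)) ->
  exists s t, [/\ s \in `[0, h], t \in `[0, h] &
    phi h h - phi h 0 - (phi 0 h - phi 0 0) = B s t * h * h].
Proof.
move=> h0 dphi dA.
have m0 : (0 : R) \in `[0, h] by rewrite in_itv /= lexx ltW.
have mh : h \in `[0, h] by rewrite in_itv /= lexx ltW.
pose G := phi^~ h - phi^~ 0.
have dG s : s \in `[0, h] -> is_derive s 1 G (A s h - A s 0).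
  by move=> sh; apply: is_deriveB; apply: dphi.
have G0h : {within `[0, h], continuous G}.
  by apply: derivable_within_continuous => s /dG[].
have [s sh Es] := MVT_segment (ltW h0)
  (fun s hs => dG s (subset_itv_oo_cc hs)) G0h.
have As : {within `[0, h], continuous (A s)}.
  by apply: derivable_within_continuous => t /(dA _ _ sh)[].
have [t th Et] := MVT_segment (ltW h0)
  (fun t ht => dA s t sh (subset_itv_oo_cc ht)) As.
exists s, t; split=> //.
by move: Es; rewrite Et subr0.
Qed.

(** The second difference of f along v and w over a small square of side h is
    symmetric in v and w, and equals h^2 times a value of fvw near x and also
    h^2 times a value of fwv near x.  By continuity, fvw x and fwv x are
    arbitrarily close. *)
Lemma mixed_derivatives_eq {R : realType} {V : normedModType R}
    {f fv fw fvw fwv : V -> R} {x v w : V} :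
  (\forall y \near x, [/\ is_derive y v f (fv y), is_derive y w f (fw y),
    is_derive y w fv (fvw y) & is_derive y v fw (fwv y)]) ->
  fvw y @[y --> x] --> fvw x -> fwv y @[y --> x] --> fwv x ->
  fvw x = fwv x.
Proof.
move=> df cvw cwv; apply/eqP; rewrite -subr_eq0 -normr_le0.
apply/ler_addgt0Pl => e e0; rewrite addr0.
have e20 : 0 < e / 2 by lra.
move/cvgrPdist_lt/(_ _ e20) : cvw => cvw.
move/cvgrPdist_lt/(_ _ e20) : cwv => cwv.
have [d /= d0 xd] := (nbhs_normP _ _).1 (filterI df (filterI cvw cwv)).
(* With this M, the whole square of side h spanned by v and w at x stays
   in the ball of radius d. *)
set M := 1 + `|v| + `|w|.
have M0 : 0 < M by rewrite /M; have := normr_ge0 v; have := normr_ge0 w; lra.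
pose h := d / 2 / M.
have h0 : 0 < h by rewrite /h !divr_gt0.
have inball s t : s \in `[0, h] -> t \in `[0, h] ->
    ball_ Num.norm x d (s *: v + (t *: w + x)).
  rewrite !in_itv /= => /andP[s0 sh] /andP[t0 th].
  rewrite /ball_ /= addrA opprD addrCA subrr addr0 normrN.
  apply: (le_lt_trans (ler_normD _ _)); rewrite !normrZ !ger0_norm//.
  have -> : d = 2 * (h * M) by rewrite /h mulfVK ?gt_eqF//; field.
  have : s * `|v| <= h * `|v| by exact: ler_wpM2r.
  have : t * `|w| <= h * `|w| by exact: ler_wpM2r.
  have := mulr_gt0 h0 M0.
  rewrite /M !mulrDr mulr1; lra.
have swap a b : a *: v + (b *: w + x) = b *: w + (a *: v + x).
  exact: addrCA.
have dfv s t : s \in `[0, h] -> t \in `[0, h] ->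
    is_derive s 1 (fun s => f (s *: v + (t *: w + x))) (fv (s *: v + (t *: w + x))).
  by move=> sh th; apply: is_derive_line; case: (xd _ (inball s t sh th)) => -[].
have dfw t s : t \in `[0, h] -> s \in `[0, h] ->
    is_derive t 1 (fun t => f (s *: v + (t *: w + x))) (fw (s *: v + (t *: w + x))).
  move=> th sh; under eq_fun do rewrite swap; apply: is_derive_line.
  by rewrite -swap; case: (xd _ (inball s t sh th)) => -[].
have dfvw s t : s \in `[0, h] -> t \in `[0, h] ->
    is_derive t 1 (fun t => fv (s *: v + (t *: w + x))) (fvw (s *: v + (t *: w + x))).
  move=> sh th; under eq_fun do rewrite swap; apply: is_derive_line.
  by rewrite -swap; case: (xd _ (inball s t sh th)) => -[].
have dfwv t s : t \in `[0, h] -> s \in `[0, h] ->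
    is_derive s 1 (fun s => fw (s *: v + (t *: w + x))) (fwv (s *: v + (t *: w + x))).
  by move=> th sh; apply: is_derive_line; case: (xd _ (inball s t sh th)) => -[].
have [s1 [t1 [s1h t1h E1]]] :=
  mixed_difference_mean_value (phi := fun s t => f (s *: v + (t *: w + x)))
    h0 dfv dfvw.
have [t2 [s2 [t2h s2h E2]]] :=
  mixed_difference_mean_value (phi := fun t s => f (s *: v + (t *: w + x)))
    h0 dfw dfwv.
have E : fvw (s1 *: v + (t1 *: w + x)) = fwv (s2 *: v + (t2 *: w + x)).
  apply: (mulIf (lt0r_neq0 h0)); apply: (mulIf (lt0r_neq0 h0)).
  by rewrite -E1 -E2; ring.
have [_ [/= B1 _]] := xd _ (inball _ _ s1h t1h).
have [_ [/= _ B2]] := xd _ (inball _ _ s2h t2h).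
rewrite E in B1.
apply: (le_trans (ler_distD (fwv (s2 *: v + (t2 *: w + x))) _ _)).
by rewrite (distrC _ (fwv x)); lra.
Qed.

(** * Partial derivatives relative to a set *)

Lemma cvg_shift_line {R : realType} {m} (v x : 'rV[R]_m) :
  h *: v + x @[h --> (0 : R)^'] --> x.
Proof.
have : h *: v + x @[h --> (0 : R)] --> x.
  rewrite -{2}[x]add0r -(scale0r v).
  by apply: cvgD; [apply: cvgZr_tmp; exact: cvg_id|exact: cvg_cst].
by move=> c; apply: (cvg_within_filter _ c).
Qed.

(** The restriction to increments that stay in S is void when S contains a
    segment around x in the direction considered.  This covers both the points
    of U and, for tangential directions, the points of Omega. *)
Lemma is_partial_cvg {R : realType} {m} {S : set 'rV[R]_m} {i : 'I_m}
    {f g : 'rV[R]_m -> R} {x : 'rV[R]_m} :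
  is_partial S i f g -> S x ->
  (\forall h \near (0 : R)^', S (h *: delta_mx 0 i + x)) ->
  h^-1 *: (f (h *: delta_mx 0 i + x) - f x) @[h --> (0 : R)^'] --> g x.
Proof.
move=> [_ fg] Sx nS.
apply: cvg_trans (fg x Sx); apply: cvg_app => P WP.
by apply: filter_app nS; exact: WP.
Qed.

Lemma is_partial_is_derive {R : realType} {m} {S : set 'rV[R]_m} {i : 'I_m}
    {f g : 'rV[R]_m -> R} {x : 'rV[R]_m} :
  is_partial S i f g -> (\forall y \near x, S y) ->
  is_derive x (delta_mx 0 i) f (g x).
Proof.
move=> fg nS.
have c := is_partial_cvg fg (nbhs_singleton nS) (cvg_shift_line _ _ _ nS).
by split; [apply/cvg_ex; exists (g x)| exact: cvg_lim].
Qed.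

Lemma within_continuous_near {R : realType} {T : topologicalType} {S : set T}
    {g : T -> R} {x : T} :
  {within S, continuous g} -> (\forall y \near x, S y) ->
  g y @[y --> x] --> g x.
Proof.
move=> /subspace_continuousP cg nS.
apply: cvg_trans (cg x (nbhs_singleton nS)); apply: cvg_app => P WP.
by apply: filter_app nS; exact: WP.
Qed.

(** Transfers identities from U to its boundary points in S, where difference
    quotients may carry no information. *)
Lemma within_continuous_eq_closure {R : realType} {T : topologicalType}
    {U S : set T} {g1 g2 : T -> R} :
  U `<=` S -> S `<=` closure U ->
  {within S, continuous g1} -> {within S, continuous g2} ->
  {in U, g1 =1 g2} -> {in S, g1 =1 g2}.
Proof.
move=> US SU /subspace_continuousP c1 /subspace_continuousP c2 eU x /set_mem Sx.
have pU : ProperFilter (within U (nbhs x)) by apply: within_nbhs_proper; exact: SU.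
have toU (g : T -> R) : g y @[y --> within S (nbhs x)] --> g x ->
    g y @[y --> within U (nbhs x)] --> g x.
  by apply: cvg_trans; apply: cvg_app; exact: within_subset.
apply: (@cvg_unique R (@Rhausdorff R) (g1 y @[y --> within U (nbhs x)])).
  exact: toU (c1 _ Sx).
apply: cvg_trans (toU _ (c2 _ Sx)); apply: near_eq_cvg.
by rewrite near_withinE; near=> y => Uy; rewrite eU ?inE.
Unshelve. all: by end_near.
Qed.

(** The limit may be along the trivial filter, which the algebra of limits
    allows; continuity of f1 relative to S replaces differentiability in the
    usual argument. *)
Lemma is_partialM {R : realType} {m} {S : set 'rV[R]_m} {i : 'I_m}
    {f1 f2 g1 g2 : 'rV[R]_m -> R} :
  {within S, continuous f1} -> {within S, continuous f2} ->
  is_partial S i f1 g1 -> is_partial S i f2 g2 ->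
  is_partial S i (fun y => f1 y * f2 y) (fun y => f1 y * g2 y + g1 y * f2 y).
Proof.
move=> /subspace_continuousP cf1 /subspace_continuousP cf2.
move=> [/subspace_continuousP cg1 d1] [/subspace_continuousP cg2 d2].
split; first by apply/subspace_continuousP => x Sx; apply: cvgD; apply: cvgM;
  [exact: cf1|exact: cg2|exact: cg1|exact: cf2].
move=> x Sx.
set F := within _ _.
have shift0 : h *: delta_mx 0 i + x @[h --> F] --> within S (nbhs x).
  by move=> P SP; exact: (cvg_shift_line (delta_mx 0 i) x _ SP).
apply: (@cvg_trans _ ((fun h : R =>
  f1 (h *: delta_mx 0 i + x) * (h^-1 *: (f2 (h *: delta_mx 0 i + x) - f2 x))
  + h^-1 *: (f1 (h *: delta_mx 0 i + x) - f1 x) * f2 x) @ F)).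
  by apply: near_eq_cvg; near=> h; rewrite /GRing.scale /=; ring.
apply: cvgD; apply: cvgM.
- exact: cvg_comp shift0 (cf1 _ Sx).
- exact: d2.
- exact: d1.
- exact: cvg_cst.
Unshelve. all: by end_near.
Qed.

Lemma is_partialD {R : realType} {m} {S : set 'rV[R]_m} {i : 'I_m}
    {f1 f2 g1 g2 : 'rV[R]_m -> R} :
  is_partial S i f1 g1 -> is_partial S i f2 g2 ->
  is_partial S i (fun y => f1 y + f2 y) (fun y => g1 y + g2 y).
Proof.
move=> [/subspace_continuousP cg1 d1] [/subspace_continuousP cg2 d2].
split; first by apply/subspace_continuousP => x Sx; apply: cvgD;
  [exact: cg1|exact: cg2].
move=> x Sx.
apply: (@cvg_trans _ ((h^-1 *: (f1 (h *: delta_mx 0 i + x) - f1 x)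
  + h^-1 *: (f2 (h *: delta_mx 0 i + x) - f2 x))
  @[h --> within [set h | S (h *: delta_mx 0 i + x)] 0^'])).
  by apply: near_eq_cvg; near=> h; rewrite /GRing.scale /=; ring.
by apply: cvgD; [exact: d1|exact: d2].
Unshelve. all: by end_near.
Qed.

Lemma is_partial_sum {R : realType} {m} {S : set 'rV[R]_m} {i : 'I_m} {k : nat}
    {f g : 'I_k -> 'rV[R]_m -> R} :
  (forall j, is_partial S i (f j) (g j)) ->
  is_partial S i (fun y => \sum_j f j y) (fun y => \sum_j g j y).
Proof.
elim: k f g => [|k IH] f g fg.
  have E (a : 'I_0 -> 'rV[R]_m -> R) : (fun y => \sum_j a j y) = (fun=> 0).
    by apply/funext => y; rewrite big_ord0.
  rewrite !E; split; first by apply/subspace_continuousP => x _; exact: cvg_cst.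
  by move=> x _; rewrite subrr; under eq_fun do rewrite scaler0; exact: cvg_cst.
have E (a : 'I_k.+1 -> 'rV[R]_m -> R) :
    (fun y => \sum_j a j y) = (fun y => a ord0 y + \sum_j a (lift ord0 j) y).
  by apply/funext => y; rewrite big_ord_recl.
by rewrite !E; apply: is_partialD => //; apply: IH => j.
Qed.

Lemma is_partial_unique {R : realType} {m} {U S : set 'rV[R]_m} {i : 'I_m}
    {f g1 g2 : 'rV[R]_m -> R} :
  open U -> U `<=` S -> S `<=` closure U ->
  is_partial S i f g1 -> is_partial S i f g2 -> {in S, g1 =1 g2}.
Proof.
move=> oU US SU fg1 fg2.
apply: (within_continuous_eq_closure US SU fg1.1 fg2.1).
move=> x /set_mem Ux.
have nS : \forall y \near x, S y by apply: filterS US _; exact: open_nbhs_nbhs.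
have [_ <-] := is_partial_is_derive fg1 nS.
by have [_ <-] := is_partial_is_derive fg2 nS.
Qed.

(** On U this is the symmetry of classical second derivatives; continuity up to
    the rest of S does the remainder. *)
Lemma partialC {R : realType} {m} {U S : set 'rV[R]_m} (i j : 'I_m)
    {u : 'rV[R]_m -> R} :
  open U -> U `<=` S -> S `<=` closure U -> C2_on S u ->
  {in S, partial S i (partial S j u) =1 partial S j (partial S i u)}.
Proof.
move=> oU US SU [[_ du] d2u].
have ddu k l : is_partial S k (partial S l u) (partial S k (partial S l u)).
  by case: (d2u l).
apply: (within_continuous_eq_closure US SU (ddu i j).1 (ddu j i).1).
move=> x /set_mem Ux.
have nS y : U y -> \forall z \near y, S z.
  by move=> Uy; apply: filterS US _; exact: open_nbhs_nbhs.
apply: (mixed_derivatives_eq (f := u) (fv := partial S j u) (fw := partial S i u)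
  (v := delta_mx 0 j) (w := delta_mx 0 i)).
- have : \forall y \near x, U y by exact: open_nbhs_nbhs.
  apply: filterS => y /nS nSy.
  by split; apply: is_partial_is_derive nSy.
- by apply: within_continuous_near (nS _ Ux); case: (ddu i j).
- by apply: within_continuous_near (nS _ Ux); case: (ddu j i).
Qed.

(** * Restriction to the hyperplane *)

Lemma continuous_inj_hyperplane {R : realType} {n} :
  continuous (@inj_hyperplane R n).
Proof.
move=> x.
apply/(@cvg_ballP R 'rV[R]_(n + 1) 'rV[R]_n (nbhs x) (nbhs_filter x)) => e e0.
near=> y.
have : ball x e y by near: y; exact: nbhsx_ballx.
case=> _ xy; split=> // i j; rewrite !mxE.
case: splitP => k _; last by rewrite !mxE; exact: ballxx.
exact: xy.
Unshelve. all: by end_near.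
Qed.

Lemma inj_hyperplane_shift {R : realType} {n} (i : 'I_n) (h : R) (x : 'rV[R]_n) :
  inj_hyperplane (h *: delta_mx 0 i + x)
    = h *: delta_mx 0 (lshift 1 i) + inj_hyperplane x.
Proof.
rewrite /inj_hyperplane.
have -> : delta_mx 0 (lshift 1 i) = row_mx (delta_mx 0 i) 0 :> 'rV[R]_(n + 1).
  apply/rowP => k; rewrite -(splitK k); case: (fintype.split k) => l /=.
    by rewrite row_mxEl !mxE (inj_eq (@lshift_inj _ _)).
  by rewrite row_mxEr !mxE eq_rlshift.
by rewrite scale_row_mx add_row_mx scaler0 addr0.
Qed.

(** Tangential increments at a point of Omega stay in Omega, hence in S, so no
    one-sidedness occurs. *)
Lemma is_derive_trace {R : realType} {n} {S : set 'rV[R]_(n + 1)}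
    {Omega : set 'rV[R]_n} {i : 'I_n} {f g : 'rV[R]_(n + 1) -> R} {x : 'rV[R]_n} :
  open Omega -> [set inj_hyperplane y | y in Omega] `<=` S -> Omega x ->
  is_partial S (lshift 1 i) f g ->
  is_derive x (delta_mx 0 i) (f \o @inj_hyperplane R n) (g (inj_hyperplane x)).
Proof.
move=> oO OS Ox fg.
have nO : \forall h \near (0 : R)^', Omega (h *: delta_mx 0 i + x).
  by apply: cvg_shift_line; exact: open_nbhs_nbhs.
have c : h^-1 *: (((f \o @inj_hyperplane R n) \o shift x) (h *: delta_mx 0 i)
    - (f \o @inj_hyperplane R n) x) @[h --> (0 : R)^'] --> g (inj_hyperplane x).
  under eq_fun do rewrite /= inj_hyperplane_shift.
  apply: is_partial_cvg fg _ _; first by apply: OS; exists x.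
  apply: filterS nO => h Oh; apply: OS; rewrite -inj_hyperplane_shift.
  by exists (h *: delta_mx 0 i + x).
by split; [apply/cvg_ex; eexists; exact: c| exact: cvg_lim].
Qed.

Lemma continuous_trace {R : realType} {n} {S : set 'rV[R]_(n + 1)}
    {Omega : set 'rV[R]_n} {g : 'rV[R]_(n + 1) -> R} {x : 'rV[R]_n} :
  open Omega -> [set inj_hyperplane y | y in Omega] `<=` S -> Omega x ->
  {within S, continuous g} ->
  g (inj_hyperplane y) @[y --> x] --> g (inj_hyperplane x).
Proof.
move=> oO OS Ox /subspace_continuousP cg P nP.
have nO : \forall y \near x, Omega y by exact: open_nbhs_nbhs.
have Sx : S (inj_hyperplane x) by apply: OS; exists x.
have nSP := continuous_inj_hyperplane x _ (cg _ Sx _ nP).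
apply: filterS2 nO nSP => y Oy; apply.
by apply: OS; exists y.
Qed.

Lemma near_sgr {R : realType} {T : topologicalType} {f : T -> R} {x : T} :
  f y @[y --> x] --> f x -> f x != 0 -> \forall y \near x, Num.sg (f y) = Num.sg (f x).
Proof.
move=> cf; rewrite neq_lt => /orP[fx|fx].
  have fy := cvgr_lt _ cf _ fx; near=> y.
  by rewrite !ltr0_sg//; near: y; exact: fy.
have fy := cvgr_gt _ cf _ fx; near=> y.
by rewrite !gtr0_sg//; near: y; exact: fy.
Unshelve. all: by end_near.
Qed.

(** * The equation on the boundary *)

Theorem theorem2 (R : realType) (n : nat) (U : set 'rV[R]_(n + 1))
    (Omega : set 'rV[R]_n) (u : 'rV[R]_(n + 1) -> R)
    (openU : open U) (openOmega : open Omega)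
    (OmegaU : [set inj_hyperplane x | x in Omega] `<=` frontier U)
    (harm_u : harmonic_on (U `|` [set inj_hyperplane x | x in Omega]) u) :
  let S := U `|` [set inj_hyperplane x | x in Omega] in
  let Du := fun y => \row_(i < n) partial S (lshift 1 i) u y in
  let Dnu := partial S (normal_index n) u in
  let p := fun y => sqr_enorm (Du y) + Dnu y ^+ 2 in
  let q := partial S (normal_index n) p in
  let sigma := fun y => Num.sg (Dnu y) in
  let F := fun x : 'rV[R]_n =>
    let y := inj_hyperplane x in
    (Num.sqrt (p y - sqr_enorm (Du y)))^-1 *: Du y in
  is_partial S (normal_index n) p q /\
  forall x : 'rV[R]_n, Omega x ->
    let y := inj_hyperplane x in
    Dnu y != 0 ->
    div_derivable F x /\
    div F x + 2^-1 * (sigma y * q y / (p y - sqr_enorm (Du y))) = 0.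
Proof.
move=> S Du Dnu p q sigma F.
case: harm_u => C2u; rewrite -/S in C2u * => lap.
pose D k := partial S k u.
pose H k l := partial S k (D l).
have US : U `<=` S by move=> y; left.
have SU : S `<=` closure U.
  by move=> y [/subset_closure//|/OmegaU[]].
have OS : [set inj_hyperplane y | y in Omega] `<=` S by move=> y; right.
have [_ d2u] := C2u.
have cD k : {within S, continuous (D k)} by exact: (d2u k).1.
have dD k l : is_partial S k (D l) (H k l) by exact: (d2u l).2 k.
have HC k l : {in S, H k l =1 H l k} by exact: (partialC k l openU US SU C2u).
pose nu := normal_index n.
have pE : p = (fun y => \sum_k D k y * D k y).
  apply/funext => y; rewrite big_split_ord /= big_ord1 /p /sqr_enorm expr2.
  by congr (_ + _); apply: eq_bigr => i _; rewrite mxE expr2.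
have dp : is_partial S nu p (fun y => \sum_k (D k y * H nu k y + H nu k y * D k y)).
  by rewrite pE; apply: is_partial_sum => k; apply: is_partialM.
(* q is a choice among the normal derivatives of p, so one must exist. *)
have dq : is_partial S nu p q.
  by apply: (xgetPex (fun=> 0)); eexists; exact: dp.
split=> // x Ox y Dy0.
have Sy : S y by apply: OS; exists x.
have pD z : p z - sqr_enorm (Du z) = D nu z ^+ 2 by rewrite /p addrC addKr.
(* The quotient rule for s D_i u / D_nu u, with the sign s frozen at x. *)
pose dF i := sigma y * ((D nu y)^-1 * H (lshift 1 i) (lshift 1 i) y
  - D (lshift 1 i) y * (D nu y ^- 2 * H (lshift 1 i) nu y)).
have FE i : is_derive x (delta_mx 0 i) (fun z => F z 0 i) (dF i).
  pose tr k := D k \o @inj_hyperplane R n.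
  have dtr k : is_derive x (delta_mx 0 i) (tr k) (H (lshift 1 i) k y).
    exact: (is_derive_trace openOmega OS Ox (dD _ _)).
  have dV : is_derive x (delta_mx 0 i) (fun z => (tr nu z)^-1)
      (- tr nu x ^- 2 *: H (lshift 1 i) nu y).
    have [dn dnE] := dtr nu.
    by split; [exact: derivableV|rewrite deriveV// dnE].
  have dK := is_deriveZ (sigma y) (is_deriveM dV (dtr (lshift 1 i))).
  have -> : dF i = sigma y *: ((tr nu x)^-1 *: H (lshift 1 i) (lshift 1 i) y
     + tr (lshift 1 i) x *: (- tr nu x ^- 2 *: H (lshift 1 i) nu y)).
    by rewrite /dF /GRing.scale /= mulNr mulrN.
  apply: near_eq_is_derive dK.
  have := near_sgr (continuous_trace openOmega OS Ox (cD nu)) Dy0.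
  apply: filterS => z sz.
  rewrite /F pD sqrtr_sqr !mxE normrEsg invfM.
  by rewrite invr_sg sz -mulrA.
split; first by move=> i; case: (FE i).
have qE : q y = 2 * (\sum_(i < n) D (lshift 1 i) y * H nu (lshift 1 i) y
    + D nu y * H nu nu y).
  rewrite (is_partial_unique openU US SU dq dp) ?inE//.
  rewrite big_split_ord /= big_ord1 mulrDr mulr_sumr -/nu.
  by congr (_ + _); [apply: eq_bigr => i _; ring|ring].
have divE : div F x = sigma y * ((D nu y)^-1
    * (\sum_(i < n) H (lshift 1 i) (lshift 1 i) y)
    - D nu y ^- 2 * \sum_(i < n) D (lshift 1 i) y * H nu (lshift 1 i) y).
  rewrite !mulr_sumr -sumrB mulr_sumr; apply: eq_bigr => i _.
  by have [_ ->] := FE i; rewrite /dF HC ?inE// mulrCA.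
have lapE : \sum_(i < n) H (lshift 1 i) (lshift 1 i) y = - H nu nu y.
  by apply/eqP; rewrite -addr_eq0; have := lap y Sy;
    rewrite big_split_ord /= big_ord1 => ->.
rewrite pD qE divE lapE.
have Dn0 : D nu y != 0 by exact: Dy0.
by field.
Qed.
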